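(* The scheme $$\sim(\sim\alpha\wedge_{d}(\sim\beta\wedge_{d}(\sim\gamma\wedge_{d}\sim(\alpha\vee(\beta\vee\gamma)))))\rightarrow_{d}((\alpha\vee(\beta\vee\sim\gamma))\rightarrow_{d}(\alpha\vee\beta))$$ is not provable in the axiom system $\mathrm{D}$; that is, there are formulas $\alpha,\beta,\gamma$ for which this formula is not a theorem of $\mathrm{D}$.
   Context: Formulas are built from a countably infinite set of propositional variables using the unary connective $\sim$ (negation) and the binary connectives $\vee$ (disjunction), $\rightarrow_{d}$ (discussive implication), $\wedge_{d}$ (discussive conjunction), all treated as primitive. $\sim$ binds more tightly than the binary connectives. The axiom system $\mathrm{D}$ has as its sole rule modus ponens for $\rightarrow_{d}$ (from $\alpha$ and $\alpha\rightarrow_{d}\beta$ infer $\beta$), and as axioms all instances (for arbitrary formulas $\alpha,\beta,\gamma$) of the following schemes: D1: $\alpha\rightarrow_{d}(\beta\rightarrow_{d}\alpha)$. D2: $(\alpha\rightarrow_{d}(\beta\rightarrow_{d}\gamma))\rightarrow_{d}((\alpha\rightarrow_{d}\beta)\rightarrow_{d}(\alpha\rightarrow_{d}\gamma))$. D3: $((\alpha\rightarrow_{d}\beta)\rightarrow_{d}\alpha)\rightarrow_{d}\alpha$. D4: $(\alpha\wedge_{d}\beta)\rightarrow_{d}\alpha$. D5: $(\alpha\wedge_{d}\beta)\rightarrow_{d}\beta$. D6: $\alpha\rightarrow_{d}(\beta\rightarrow_{d}(\alpha\wedge_{d}\beta))$. D7: $\alpha\rightarrow_{d}(\alpha\vee\beta)$.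 D8: $\beta\rightarrow_{d}(\alpha\vee\beta)$. D9: $(\alpha\rightarrow_{d}\gamma)\rightarrow_{d}((\beta\rightarrow_{d}\gamma)\rightarrow_{d}((\alpha\vee\beta)\rightarrow_{d}\gamma))$. D10: $\alpha\rightarrow_{d}\sim\sim\alpha$. D11: $\sim\sim\alpha\rightarrow_{d}\alpha$. D12: $\sim(\alpha\vee\sim\alpha)\rightarrow_{d}\beta$. D13: $\sim(\alpha\vee\beta)\rightarrow_{d}\sim(\beta\vee\alpha)$. D14: $\sim(\alpha\vee\beta)\rightarrow_{d}(\sim\beta\wedge_{d}\sim\alpha)$. D15: $\sim(\sim\sim\alpha\vee\beta)\rightarrow_{d}\sim(\alpha\vee\beta)$. D16: $((\sim(\alpha\vee\beta))\rightarrow_{d}\gamma)\rightarrow_{d}((\sim\alpha\rightarrow_{d}\beta)\vee\gamma)$. D17: $\sim((\alpha\vee\beta)\vee\gamma)\rightarrow_{d}\sim(\alpha\vee(\beta\vee\gamma))$. D18: $\sim((\alpha\rightarrow_{d}\beta)\vee\gamma)\rightarrow_{d}(\alpha\wedge_{d}\sim(\beta\vee\gamma))$. D19: $\sim((\alpha\wedge_{d}\beta)\vee\gamma)\rightarrow_{d}(\alpha\rightarrow_{d}\sim(\beta\vee\gamma))$. D20: $\sim(\sim(\alpha\vee\beta)\vee\gamma)\rightarrow_{d}(\sim(\sim\alpha\vee\gamma)\vee\sim(\sim\beta\vee\gamma))$. D21: $\sim(\sim(\alpha\rightarrow_{d}\beta)\vee\gamma)\rightarrow_{d}(\alpha\rightarrow_{d}\sim(\sim\beta\vee\gamma))$.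 D22: $\sim(\sim(\alpha\wedge_{d}\beta)\vee\gamma)\rightarrow_{d}(\alpha\wedge_{d}\sim(\sim\beta\vee\gamma))$. A theorem of $\mathrm{D}$ is a formula derivable from these axioms by finitely many applications of modus ponens. A scheme is said to be unprovable in $\mathrm{D}$ if at least one of its instances is not a theorem of $\mathrm{D}$. *)

(* Defs.v *)
Inductive formula : Type :=
| Var : nat -> formula
| Neg : formula -> formula
| Disj : formula -> formula -> formula
| DImp : formula -> formula -> formula
| DConj : formula -> formula -> formula.

Declare Scope formula_scope.
Delimit Scope formula_scope with F.
Bind Scope formula_scope with formula.

Notation "~ a" := (Neg a) : formula_scope.
Notation "a \/ b" := (Disj a b) : formula_scope.
Notation "a /\d b" := (DConj a b) (at level 80, right associativity) : formula_scope.
Notation "a ->d b" := (DImp a b) (at level 99, right associativity) : formula_scope.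

Inductive D_axiom : formula -> Prop :=
| D1 a b : D_axiom (a ->d (b ->d a))
| D2 a b c : D_axiom ((a ->d (b ->d c)) ->d ((a ->d b) ->d (a ->d c)))
| D3 a b : D_axiom (((a ->d b) ->d a) ->d a)
| D4 a b : D_axiom ((a /\d b) ->d a)
| D5 a b : D_axiom ((a /\d b) ->d b)
| D6 a b : D_axiom (a ->d (b ->d (a /\d b)))
| D7 a b : D_axiom (a ->d (a \/ b))
| D8 a b : D_axiom (b ->d (a \/ b))
| D9 a b c : D_axiom ((a ->d c) ->d ((b ->d c) ->d ((a \/ b) ->d c)))
| D10 a : D_axiom (a ->d ~ ~ a)
| D11 a : D_axiom (~ ~ a ->d a)
| D12 a b : D_axiom (~ (a \/ ~ a) ->d b)
| D13 a b : D_axiom (~ (a \/ b) ->d ~ (b \/ a))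
| D14 a b : D_axiom (~ (a \/ b) ->d (~ b /\d ~ a))
| D15 a b : D_axiom (~ (~ ~ a \/ b) ->d ~ (a \/ b))
| D16 a b c : D_axiom ((~ (a \/ b) ->d c) ->d ((~ a ->d b) \/ c))
| D17 a b c : D_axiom (~ ((a \/ b) \/ c) ->d ~ (a \/ (b \/ c)))
| D18 a b c : D_axiom (~ ((a ->d b) \/ c) ->d (a /\d ~ (b \/ c)))
| D19 a b c : D_axiom (~ ((a /\d b) \/ c) ->d (a ->d ~ (b \/ c)))
| D20 a b c : D_axiom (~ (~ (a \/ b) \/ c) ->d (~ (~ a \/ c) \/ ~ (~ b \/ c)))
| D21 a b c : D_axiom (~ (~ (a ->d b) \/ c) ->d (a ->d ~ (~ b \/ c)))
| D22 a b c : D_axiom (~ (~ (a /\d b) \/ c) ->d (a /\d ~ (~ b \/ c))).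

Inductive D_theorem : formula -> Prop :=
| D_theorem_axiom a : D_axiom a -> D_theorem a
| D_theorem_mp a b : D_theorem a -> D_theorem (a ->d b) -> D_theorem b.

(* Main.v *)
Require Import Defs.

(** Jaskowski's reading of discussive logic: evaluate formulas in an S5 model
    with universal accessibility, read [a ->d b] as "possibly [a] implies [b]"
    and [a /\d b] as "possibly [a], and [b]", and call a formula accepted when
    it is possible.  All axioms of D are accepted and modus ponens preserves
    acceptance.  Two worlds refute the scheme: take [a] and [b] false
    everywhere and [c] true in exactly one world.  Then [c], hence
    [a \/ (b \/ c)], holds somewhere, which makes the negated conjunction
    possible, and [a \/ (b \/ ~ c)] is possible as well, but [a \/ b] is not. *)

Definition possible (p : bool -> bool) : bool := p true || p false.

Fixpoint holds (v : nat -> bool -> bool) (f : formula) (w : bool) : bool :=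
  match f with
  | Var n => v n w
  | Neg a => negb (holds v a w)
  | Disj a b => holds v a w || holds v b w
  | DImp a b => implb (possible (holds v a)) (holds v b w)
  | DConj a b => possible (holds v a) && holds v b w
  end.

Definition accepted (v : nat -> bool -> bool) (f : formula) : Prop :=
  possible (holds v f) = true.

(** The truth value of possibly [a] is the same at both worlds, so possibility distributes over the
    implication; this gives soundness of modus ponens. *)
Lemma accepted_DImp v a b :
  accepted v (DImp a b) <-> (accepted v a -> accepted v b).
Proof.
  unfold accepted, possible; cbn; unfold possible.
  destruct (holds v a true), (holds v a false), (holds v b true), (holds v b false);
    cbn; intuition congruence.
Qed.

Lemma D_axiom_accepted v f : D_axiom f -> accepted v f.
Proof.
  intros H; unfold accepted.
  destruct H; unfold possible; cbn; unfold possible; cbn;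
    (* A schematic letter matters only through its values at the two worlds, so each scheme is a
       finite truth table. *)
    repeat match goal with
    | |- context [holds v ?x ?w] => destruct (holds v x w); cbn
    end; reflexivity.
Qed.

Lemma D_theorem_accepted v f : D_theorem f -> accepted v f.
Proof.
  induction 1 as [f Hf | a b _ IHa _ IHab].
  - now apply D_axiom_accepted.
  - now apply (accepted_DImp v a b).
Qed.

Theorem proposition2p15 :
  exists a b c : formula,
    ~ D_theorem
        (~ (~ a /\d (~ b /\d (~ c /\d ~ (a \/ (b \/ c)))))
           ->d ((a \/ (b \/ ~ c)) ->d (a \/ b))).
Proof.
  exists (Var 0), (Var 1), (Var 2); intros H.
  (* Worlds are booleans, so the value [w] makes variable 2 true at world [true] only. *)
  apply (D_theorem_accepted (fun n w => match n with 2 => w | _ => false end)) in H.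
  discriminate H.
Qed.
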